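(* Let $n,m\ge 3$ be integers. Then (i) $\mu_{\rm d}(K_n \,\square\, K_m) = n+m-1$, and (ii) $\mu_{\rm o}(K_n \,\square\, K_m) = n+m-2$.
   Context: $K_n\,\square\,K_m$ is the Cartesian product of complete graphs: vertex set $[n]\times[m]$, with $(i,j)$ adjacent to $(i',j')$ iff either $i=i'$ and $j\ne j'$, or $j=j'$ and $i\neq i'$. For a connected graph $G$ and $X\subseteq V(G)$, two vertices $x,y$ are $X$-visible if there is a shortest $x,y$-path whose internal vertices are not in $X$. $X$ is a dual mutual-visibility set if every two vertices of $X$ are $X$-visible and every two vertices of $V(G)\setminus X$ are $X$-visible; $X$ is an outer mutual-visibility set if every two vertices of $X$ are $X$-visible and every $x\in X$, $y\in V(G)\setminus X$ are $X$-visible. $\mu_{\rm d}(G)$ and $\mu_{\rm o}(G)$ denote the maximum cardinality of a dual, respectively outer, mutual-visibility set of $G$. *)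

(* Defs.v *)
From HB Require Import structures.
From mathcomp Require Import all_boot.
From mathcomp Require Import boolp.

Set Implicit Arguments.
Unset Strict Implicit.
Unset Printing Implicit Defensive.

Record sgraph := SGraph {
  vertex :> finType;
  adj : rel vertex;
  adj_sym : symmetric adj;
  adj_irrefl : irreflexive adj
}.

Definition connected_graph (G : sgraph) : Prop :=
  forall x y : G, connect (@adj G) x y.

Section Complete.
Variable n : nat.

Definition complete_adj : rel 'I_n := fun i j => i != j.

Lemma complete_adj_sym : symmetric complete_adj.
Proof. by move=> i j; rewrite /complete_adj eq_sym. Qed.

Lemma complete_adj_irrefl : irreflexive complete_adj.
Proof. by move=> i; rewrite /complete_adj eqxx. Qed.

Definition complete_graph : sgraph :=
  SGraph complete_adj_sym complete_adj_irrefl.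

End Complete.

Section CartesianProduct.
Variables G H : sgraph.

Definition cartesian_adj : rel (G * H) := fun u v =>
  ((u.1 == v.1) && adj u.2 v.2) || ((u.2 == v.2) && adj u.1 v.1).

Lemma cartesian_adj_sym : symmetric cartesian_adj.
Proof.
move=> u v; rewrite /cartesian_adj (eq_sym u.1) (eq_sym u.2).
by rewrite (adj_sym u.1) (adj_sym u.2).
Qed.

Lemma cartesian_adj_irrefl : irreflexive cartesian_adj.
Proof. by move=> u; rewrite /cartesian_adj !adj_irrefl !andbF. Qed.

Definition cartesian_product : sgraph :=
  SGraph cartesian_adj_sym cartesian_adj_irrefl.

End CartesianProduct.

Section MutualVisibility.
Variable G : sgraph.
Implicit Types (x y : G) (p : seq G) (X : {set G}).

(* The sequence p omits the first vertex: the path is x :: p, of length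
   size p. *)
Definition is_path x y p : Prop :=
  [/\ path (@adj G) x p, last x p = y & uniq (x :: p)].

Definition is_shortest_path x y p : Prop :=
  is_path x y p /\ forall q, is_path x y q -> size p <= size q.

(* x :: p without its last and first items. *)
Definition internal_vertices x p : seq G := behead (belast x p).

Definition visible X x y : Prop :=
  exists2 p, is_shortest_path x y p &
    forall z, z \in internal_vertices x p -> z \notin X.

Definition dual_mutual_visibility_set X : Prop :=
  (forall x y, x \in X -> y \in X -> x != y -> visible X x y) /\
  (forall x y, x \notin X -> y \notin X -> x != y -> visible X x y).

Definition outer_mutual_visibility_set X : Prop :=
  (forall x y, x \in X -> y \in X -> x != y -> visible X x y) /\
  (forall x y, x \in X -> y \notin X -> visible X x y).

(* When G is connected the empty set qualifies for both notions, so neither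
   maximum ranges over an empty family. *)
Definition mu_d : nat :=
  \max_(X : {set G} | `[< dual_mutual_visibility_set X >]) #|X|.

Definition mu_o : nat :=
  \max_(X : {set G} | `[< outer_mutual_visibility_set X >]) #|X|.

End MutualVisibility.

Lemma connected_complete_product (n m : nat) :
  connected_graph (cartesian_product (complete_graph n) (complete_graph m)).
Proof.
move=> [i j] [i' j']; apply: (@connect_trans _ _ (i, j')).
  have [->|nj] := eqVneq j j'; first exact: connect0.
  by apply: connect1; rewrite /= /cartesian_adj /= eqxx /complete_adj nj.
have [->|ni] := eqVneq i i'; first exact: connect0.
by apply: connect1; rewrite /= /cartesian_adj /= eqxx /complete_adj ni orbT.
Qed.

(* Main.v *)
Require Import Defs.
From mathcomp Require Import all_boot.
From mathcomp Require Import boolp zify.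

(** View a vertex set [X] as a 0/1 matrix.  Two cells in distinct rows and
    columns are at distance 2, and their only common neighbours are the other
    two corners of the rectangle they span, so they are [X]-visible iff one of
    these corners lies outside [X].
    - Dual sets are those in which no 2x2 minor is all ones or a permutation
      matrix.  The rows are then nested, and two of them share at most one
      column, so at most one row has more than one element.
    - Outer sets are those in which no 2x2 minor has three ones or more: each
      element is alone in its row or alone in its column.  If all [n] rows
      contain an element which is alone in it, then [X] has just [n] elements,
      and likewise for columns; otherwise [X] has at most [(n-1) + (m-1)]
      elements. *)

Set Implicit Arguments.
Unset Strict Implicit.
Unset Printing Implicit Defensive.

Section FiberSingletons.
Variables (T R : finType) (f : T -> R).
Implicit Type X : {set T}.

(** For [f] a coordinate projection, these are the elements of [X] alone in their row or column. *)
Definition fiber_singletons X :=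
  [set u in X | [forall v in X, (f v == f u) ==> (v == u)]].

Lemma fiber_singletonsP X u :
  reflect (u \in X /\ forall v, v \in X -> f v = f u -> v = u)
          (u \in fiber_singletons X).
Proof.
rewrite inE; apply: (iffP andP) => -[uX uP]; split=> //.
  by move=> v vX fuv; apply/eqP; move/forall_inP: uP => /(_ v vX)/implyP; apply; apply/eqP.
by apply/forall_inP => v vX; apply/implyP => /eqP fuv; apply/eqP/uP.
Qed.

Lemma fiber_singletons_inj X : {in fiber_singletons X &, injective f}.
Proof.
move=> u v /fiber_singletonsP[uX _] /fiber_singletonsP[_ vP] fuv.
exact: vP.
Qed.

(** [f] is injective on the singletons. If their image is all of [R], every fiber contains one,
    which is then the only element of [X] there, so [X] has no further elements. *)
Lemma card_fiber_singletons X :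
  #|X| <= #|R| \/ #|fiber_singletons X| < #|R|.
Proof.
have cE := card_in_imset (@fiber_singletons_inj X).
have [fT|fNT] := eqVneq (f @: fiber_singletons X) setT; last first.
  by right; rewrite -cE -cardsT proper_card // properEneq fNT subsetT.
left; rewrite -cardsT -fT cE; apply/subset_leq_card/subsetP => v vX.
have /imsetP[u uS fvu] : f v \in f @: fiber_singletons X by rewrite fT inE.
by have /fiber_singletonsP[_ /(_ v vX fvu)->] := uS.
Qed.

End FiberSingletons.

(** Distinctness in the boolean form used when splitting on membership in a fixed row or column. *)
Lemma neq_not_both (T : eqType) (z x y : T) :
  x != y -> ~~ ((x == z) && (y == z)).
Proof. by apply: contra => /andP[/eqP-> /eqP->]. Qed.

Section RookGraph.
Variables n m : nat.
Local Notation G := (cartesian_product (complete_graph n) (complete_graph m)).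
Implicit Types (u v : G) (X : {set G}) (i : 'I_n) (j : 'I_m).

Lemma visible_adj X u v : adj u v -> visible X u v.
Proof.
move=> uv; have nuv : u != v.
  by apply: contraTneq uv => ->; rewrite adj_irrefl.
exists [:: v] => //; split=> [|[|w q] [_ /= quv _]] //.
  by split=> //=; [rewrite andbT | rewrite inE nuv].
by rewrite quv eqxx in nuv.
Qed.

Lemma visible_corners X i i' j j' : i != i' -> j != j' ->
  visible X ((i, j) : G) (i', j') <->
  ((i, j') : G) \notin X \/ ((i', j) : G) \notin X.
Proof.
move=> ni nj.
have path2 (w : G) : w = (i, j') \/ w = (i', j) ->
    is_path ((i, j) : G) (i', j') [:: w; (i', j')].
  move: ni nj => /negbTE ni /negbTE nj.
  case=> ->; split=> //; rewrite /= /cartesian_adj /= /complete_adj ?inE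
    ?xpair_eqE !eqxx ?ni ?nj ?orbT //.
split=> [[p [[pp pl _] pmin] pX]|].
  (* Comparison with a two-edge path bounds the length of [p] by 2; lengths 0 and 1 contradict [ni]
     and [nj]. *)
  have := pmin _ (path2 (i, j') (or_introl erefl)).
  case: p pp pl pX {pmin} => [|w [|z [|]]] //=.
  - by move=> _ [/eqP]; rewrite (negbTE ni).
  - move=> /andP[+ _] wE; rewrite wE /cartesian_adj /= /complete_adj.
    by rewrite (negbTE ni) (negbTE nj).
  - case: w => a b /and3P[+ + _] zE /(_ (a, b)); rewrite zE inE eqxx.
    rewrite /cartesian_adj /= /complete_adj.
    case/orP=> /andP[/eqP <- _] /orP[]/andP[/eqP e _] /(_ isT).
    + by rewrite e eqxx in ni.
    + by rewrite e; left.
    + by rewrite e; right.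
    + by rewrite e eqxx in nj.
have shortest (w : G) : w = (i, j') \/ w = (i', j) ->
    is_shortest_path ((i, j) : G) (i', j') [:: w; (i', j')].
  move=> wP; split=> [|[|z [|? ?]] [/= zp zE _]] //; first exact: path2.
  - by case: zE => /eqP; rewrite (negbTE ni).
  - move: zp => /andP[+ _]; rewrite zE /cartesian_adj /= /complete_adj.
    by rewrite (negbTE ni) (negbTE nj).
by case=> wX; [exists [:: (i, j') : G; (i', j')] | exists [:: (i', j) : G; (i', j')]];
  [apply: shortest; left | move=> z; rewrite inE => /eqP-> |
   apply: shortest; right | move=> z; rewrite inE => /eqP->].
Qed.

(** Distinct cells in a common row or column are adjacent, hence visible, so the corner condition
    only matters under the two inequalities. *)
Lemma visibleP X u v : u != v ->
  visible X u v <->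
  (u.1 != v.1 -> u.2 != v.2 ->
   ((u.1, v.2) : G) \notin X \/ ((v.1, u.2) : G) \notin X).
Proof.
case: u v => [i j] [i' j'] /=; rewrite xpair_eqE.
have [->|ni] /= := eqVneq i i'.
  by move=> nj; split=> // _; apply: visible_adj; rewrite /= /cartesian_adj /= /complete_adj eqxx nj.
move=> _; have [->|nj] := eqVneq j j'.
  by split=> // _; apply: visible_adj; rewrite /= /cartesian_adj /= /complete_adj eqxx ni orbT.
rewrite visible_corners //; split; [by [] | exact].
Qed.

Lemma dual_card_leq X : 0 < n ->
  dual_mutual_visibility_set X -> #|X| <= n + m - 1.
Proof.
move=> n_gt0 [Xin Xout].
have no4 i i' j j' : i != i' -> j != j' -> ((i, j) : G) \in X ->
    ((i, j') : G) \in X -> ((i', j) : G) \in X -> ((i', j') : G) \notin X.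
  move=> ni nj a b c; apply/negP => d.
  have : ((i, j) : G) != (i', j') by rewrite xpair_eqE (negbTE ni).
  by move/(Xin _ _ a d)/(visible_corners X ni nj); rewrite b c; case.
have no2 i i' j j' : i != i' -> j != j' -> ((i, j) : G) \in X ->
    ((i', j') : G) \in X -> ((i, j') : G) \notin X -> ((i', j) : G) \in X.
  move=> ni nj a d b; apply/negPn/negP => c.
  have : ((i, j') : G) != (i', j) by rewrite xpair_eqE (negbTE ni).
  rewrite eq_sym in nj.
  by move/(Xout _ _ b c)/(visible_corners X ni nj); rewrite a d; case.
(* By [no4], row [i'] misses [j] or [k]. Then [no2] puts row [i'] inside row [i], and columns [j'],
   [k'] give a minor of ones. *)
have uniq_big i i' j k j' k' : j != k -> j' != k' ->
    ((i, j) : G) \in X -> ((i, k) : G) \in X ->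
    ((i', j') : G) \in X -> ((i', k') : G) \in X -> i = i'.
  move=> njk njk' ij ik ij' ik'; apply/eqP/negPn/negP => ni.
  have ni' : i' != i by rewrite eq_sym.
  have [bj|bj] := boolP (((i', j) : G) \in X).
    have bk := no4 _ _ _ _ ni njk ij ik bj.
    have sub b : ((i', b) : G) \in X -> ((i, b) : G) \in X.
      move=> ib; have [-> //|nbk] := eqVneq b k.
      exact: (no2 i' i b k).
    have := no4 _ _ _ _ ni' njk' ij' ik' (sub _ ij').
    by rewrite sub.
  have sub b : ((i', b) : G) \in X -> ((i, b) : G) \in X.
    move=> ib; have [-> //|nbj] := eqVneq b j.
    exact: (no2 i' i b j).
  have := no4 _ _ _ _ ni' njk' ij' ik' (sub _ ij').
  by rewrite sub.
have [i0 i0P] : exists i0, forall i j k, j != k ->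
    ((i, j) : G) \in X -> ((i, k) : G) \in X -> i = i0.
  case: (pselect (exists i j k,
    [/\ j != k, ((i, j) : G) \in X & ((i, k) : G) \in X])).
    move=> [i [j [k [njk ij ik]]]]; exists i => i' j' k' njk' ij' ik'.
    exact: (uniq_big _ _ j' k' j k).
  (* No row has two elements, so any row serves as [i0]. *)
  move=> noP; exists (Ordinal n_gt0) => i j k njk ij ik.
  by case: noP; exists i, j, k.
pose D := [set u : G | u.1 == i0].
have c1 : #|X :&: D| <= m.
  rewrite -(@card_in_imset _ _ snd).
    by rewrite (leq_trans (max_card _)) ?card_ord.
  by case=> [a b] [c d]; rewrite !inE /= => /andP[_ /eqP->] /andP[_ /eqP->] ->.
(* Every row other than [i0] has at most one element, so [fst] is injective here and avoids [i0]. *)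
have c2 : #|X :\: D| <= n.-1.
  rewrite -(@card_in_imset _ _ fst); last first.
    case=> [a b] [c d]; rewrite !inE /= => /andP[na ab] /andP[_ cd] ac.
    rewrite -{c}ac in cd *; congr pair; apply/eqP/negPn/negP => nbd.
    by rewrite (i0P _ _ _ nbd ab cd) eqxx in na.
  have -> : n.-1 = #|[set~ i0]| by rewrite cardsC1 card_ord.
  apply/subset_leq_card/subsetP => a /imsetP[u]; rewrite !inE => /andP[nu _] -> //.
by rewrite -(cardsID D X); move: c1 c2 n_gt0; lia.
Qed.

Lemma outer_card_leq X : 1 < n -> 1 < m ->
  outer_mutual_visibility_set X -> #|X| <= n + m - 2.
Proof.
move=> n_gt1 m_gt1 [Xin Xout].
pose A := fiber_singletons (@fst 'I_n 'I_m) X.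
pose B := fiber_singletons (@snd 'I_n 'I_m) X.
have XAB : X \subset A :|: B.
  apply/subsetP => -[i j] ij; rewrite in_setU; apply/negPn/negP.
  rewrite negb_or => /andP[/fiber_singletonsP nA /fiber_singletonsP nB].
  apply: nA; split=> // -[i1 j'] ij' /= ii; rewrite {}ii {i1} in ij' *.
  congr pair; apply/eqP/negPn/negP => nj.
  apply: nB; split=> // -[i' j1] i'j /= jj; rewrite {}jj {j1} in i'j *.
  congr pair; apply/eqP/negPn/negP => ni.
  have ni' : i != i' by rewrite eq_sym.
  have nj' : j != j' by rewrite eq_sym.
  (* Visibility is required whether or not [(i', j')] lies in [X], yet both corners [(i, j')] and
     [(i', j)] are in [X]. *)
  have : visible X ((i, j) : G) (i', j').
    have [d|d] := boolP (((i', j') : G) \in X); last exact: Xout.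
    by apply: Xin => //; rewrite xpair_eqE (negbTE ni').
  by move/(visible_corners X ni' nj'); rewrite ij' i'j; case.
have XleAB : #|X| <= #|A| + #|B|.
  exact: leq_trans (subset_leq_card XAB) (leq_card_setU A B).
have [cn|cA] : #|X| <= n \/ #|A| < n.
- by rewrite -[n in _ <= n]card_ord -[n in _ < n]card_ord; exact: card_fiber_singletons.
(* Here [1 < m] gives [n <= n + m - 2]. *)
- by apply: leq_trans cn _; lia.
have [cm|cB] : #|X| <= m \/ #|B| < m.
- by rewrite -[m in _ <= m]card_ord -[m in _ < m]card_ord; exact: card_fiber_singletons.
- by apply: leq_trans cm _; lia.
by apply: leq_trans XleAB _; lia.
Qed.

(** Row [i] and column [j], split into disjoint pieces so that cardinalities add up. *)
Definition cross i j : {set G} :=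
  setX [set i] setT :|: setX [set~ i] [set j].

(** The cross without its centre [(i, j)]. *)
Definition punctured_cross i j : {set G} :=
  setX [set i] [set~ j] :|: setX [set~ i] [set j].

Lemma card_cross i j : #|cross i j| = n + m - 1.
Proof.
rewrite cardsU !cardsX cardsC1 !cards1 cardsT !card_ord.
(* Destructing [i] supplies [0 < n] for the truncated subtraction. *)
rewrite [_ :&: _](_ : _ = set0) ?cards0; first by case: (i) => /= a; lia.
by apply/setP => -[a b]; rewrite !inE /=; case: (a == i); rewrite ?andbF.
Qed.

Lemma card_punctured_cross i j : #|punctured_cross i j| = n + m - 2.
Proof.
rewrite cardsU !cardsX !cardsC1 !cards1 !card_ord.
rewrite [_ :&: _](_ : _ = set0) ?cards0.
  by case: (i) (j) => /= a ? [b ?]; lia.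
by apply/setP => -[a b]; rewrite !inE /=; case: (a == i); rewrite ?andbF.
Qed.

(** For [(i, b)] and [(c, j)] in the cross, the corner [(c, b)] is outside it; for two cells outside
    the cross, both corners are outside. *)
Lemma cross_dual i j : dual_mutual_visibility_set (cross i j).
Proof.
split=> -[a b] [c d] hab hcd nuv; apply/visibleP => //= /(neq_not_both i) hi
  /(neq_not_both j) hj; move: hab hcd hi hj; rewrite !inE /=;
  case: (a == i); case: (c == i); case: (b == j); case: (d == j) => //= *;
  by [left | right].
Qed.

Lemma punctured_cross_outer i j :
  outer_mutual_visibility_set (punctured_cross i j).
Proof.
(* An element of the set sees every other vertex: from [(i, b)] to [(c, d)] the corner [(c, b)] is
   free, and from [(a, j)] the corner [(a, d)]. *)
suff vis u v : u \in punctured_cross i j -> u != v ->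
    visible (punctured_cross i j) u v.
  split=> [u v uX _|u v uX vX]; apply: vis => //.
  by apply: contraTneq uX => ->.
case: u v => [a b] [c d] hab nuv; apply/visibleP => //= /(neq_not_both i) hi
  /(neq_not_both j) hj; move: hab hi hj; rewrite !inE /=;
  case: (a == i); case: (c == i); case: (b == j); case: (d == j) => //= *;
  by [left | right].
Qed.

End RookGraph.

Theorem theorem2p1 (n m : nat) (hn : 3 <= n) (hm : 3 <= m) :
  mu_d (cartesian_product (complete_graph n) (complete_graph m)) = n + m - 1
  /\ mu_o (cartesian_product (complete_graph n) (complete_graph m)) = n + m - 2.
Proof.
have n_gt0 : 0 < n by apply: leq_trans hn.
have m_gt0 : 0 < m by apply: leq_trans hm.
pose i := Ordinal n_gt0; pose j := Ordinal m_gt0.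
split; apply/eqP; rewrite eqn_leq; apply/andP; split.
- apply/bigmax_leqP => X /asboolP; exact: dual_card_leq.
- by rewrite -(card_cross i j); apply: leq_bigmax_cond; apply/asboolP/cross_dual.
- apply/bigmax_leqP => X /asboolP; apply: outer_card_leq; exact: ltnW.
- rewrite -(card_punctured_cross i j); apply: leq_bigmax_cond.
  exact/asboolP/punctured_cross_outer.
Qed.
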